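(* The following equality holds: $$\lim_{n\to\infty}\frac{1}{n}\sum_{i=0}^{n-1}\frac{1}{1+\left(\frac{i}{n}\right)^2}=\sum_{p=0}^{\infty}(-1)^p\frac{1}{2p+1}.$$
   Context: The infinite sum on the right is the limit of its partial sums, $\lim_{m\to\infty}\sum_{p=0}^{m}(-1)^p\frac{1}{2p+1}$; $n$ ranges over positive integers. *)

(* Defs.v *)
From Stdlib Require Import Reals.
From Coquelicot Require Import Coquelicot.
Local Open Scope R_scope.

(* [sum_n f m] is the sum of [f 0], ..., [f m], with both ends included.
   Meaningful for [n >= 1] only. *)
Definition riemann_mean (n : nat) : R :=
  1 / INR n * sum_n (fun i : nat => 1 / (1 + (INR i / INR n) ^ 2)) (n - 1).

Definition leibniz_term (p : nat) : R :=
  (-1) ^ p * (1 / (2 * INR p + 1)).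

(* Main.v *)
Require Import Defs.
From Stdlib Require Import Reals Lra Lia.
From Coquelicot Require Import Coquelicot.
Local Open Scope R_scope.

(** Both sides equal PI / 4.

    The left-hand side is the left Riemann sum, with step 1/n, of the
    nonincreasing function x |-> 1 / (1 + x^2) on [0, 1], whose primitive is
    atan.  By the mean value theorem, the increment of a primitive F over a step
    of length h from a to b is h * f c with c between a and b, hence lies between
    h * f b and h * f a.  Summing over the steps, the errors telescope
    ([left_sum_bounds]), and the sum lies between atan 1 = PI / 4 and
    PI / 4 + 1 / (2 n).  The squeeze theorem gives the limit
    ([riemann_mean_lim]).

    The right-hand side is the Leibniz series for PI / 4 ([leibniz_series]). *)

(** One step of a left sum overestimates the increment of the primitive [F], by
    at most the length of the step times the decrease of [f]. *)
Lemma left_step_bounds (F f : R -> R) (a b : R) :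
  a < b ->
  (forall x, a <= x <= b -> derivable_pt_lim F x (f x)) ->
  (forall x y, a <= x -> x <= y -> y <= b -> f y <= f x) ->
  F b - F a <= (b - a) * f a <= F b - F a + (b - a) * (f a - f b).
Proof.
  intros Hab HF Hf.
  destruct (MVT_cor2 F f a b Hab HF) as [c [Hc Hacb]].
  assert (Hca : f c <= f a) by (apply Hf; lra).
  assert (Hbc : f b <= f c) by (apply Hf; lra).
  rewrite Hc; split; nra.
Qed.

Lemma left_sum_bounds (F f : R -> R) (h : R) (m : nat) :
  0 < h ->
  (forall x, 0 <= x <= INR (S m) * h -> derivable_pt_lim F x (f x)) ->
  (forall x y, 0 <= x -> x <= y -> y <= INR (S m) * h -> f y <= f x) ->
  F (INR (S m) * h) - F 0
    <= h * sum_f_R0 (fun i => f (INR i * h)) m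
    <= F (INR (S m) * h) - F 0 + h * (f 0 - f (INR (S m) * h)).
Proof.
  intros Hh.
  induction m as [|m IH]; intros HF Hf.
  - cbn [sum_f_R0].
    change (INR 1) with 1 in *; change (INR 0) with 0.
    rewrite Rmult_1_l in *; rewrite Rmult_0_l.
    pose proof (left_step_bounds F f 0 h Hh HF Hf) as H.
    rewrite Rminus_0_r in H; exact H.
  - cbn [sum_f_R0].
    assert (E : INR (S (S m)) * h = INR (S m) * h + h)
      by (rewrite (S_INR (S m)); ring).
    rewrite E in *.
    assert (Ha : 0 <= INR (S m) * h)
      by (apply Rmult_le_pos; [apply pos_INR | lra]).
    set (a := INR (S m) * h) in *.
    assert (IH' : F a - F 0 <= h * sum_f_R0 (fun i => f (INR i * h)) m
                  <= F a - F 0 + h * (f 0 - f a)).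
    { apply IH.
      - intros x Hx; apply HF; lra.
      - intros x y Hx Hxy Hy; apply Hf; lra. }
    assert (Hs : F (a + h) - F a <= (a + h - a) * f a
                 <= F (a + h) - F a + (a + h - a) * (f a - f (a + h))).
    { apply left_step_bounds.
      - lra.
      - intros x Hx; apply HF; lra.
      - intros x y Hx Hxy Hy; apply Hf; lra. }
    replace (a + h - a) with h in Hs by ring.
    rewrite Rmult_plus_distr_l.
    lra.
Qed.

Lemma inv_1_plus_sqr_decreasing (x y : R) :
  0 <= x -> x <= y -> / (1 + y ^ 2) <= / (1 + x ^ 2).
Proof.
  intros Hx Hxy; apply Rinv_le_contravar; nra.
Qed.

Lemma riemann_mean_bounds (k : nat) :
  PI / 4 <= riemann_mean (S k) <= PI / 4 + / INR (S k) * / 2.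
Proof.
  assert (Hn : 0 < INR (S k)) by (apply lt_0_INR; lia).
  pose proof (left_sum_bounds atan (fun x => / (1 + x ^ 2)) (/ INR (S k)) k
    (Rinv_0_lt_compat _ Hn)
    (fun x _ => derivable_pt_lim_atan x)
    (fun x y Hx Hxy _ => inv_1_plus_sqr_decreasing x y Hx Hxy)) as H.
  rewrite (Rinv_r (INR (S k))), atan_1, atan_0 in H by lra.
  assert (E : riemann_mean (S k) =
    / INR (S k) * sum_f_R0 (fun i => / (1 + (INR i * / INR (S k)) ^ 2)) k).
  { unfold riemann_mean.
    replace (S k - 1)%nat with k by lia.
    rewrite sum_n_Reals; unfold Rdiv at 1; rewrite Rmult_1_l.
    f_equal; apply sum_eq; intros i _.
    unfold Rdiv; apply Rmult_1_l. }
  rewrite E.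
  replace (/ (1 + 0 ^ 2) - / (1 + 1 ^ 2)) with (/ 2) in H by field.
  lra.
Qed.

Lemma riemann_mean_lim :
  is_lim_seq (fun k : nat => riemann_mean (S k)) (PI / 4).
Proof.
  apply (is_lim_seq_le_le (fun _ => PI / 4) _
           (fun k => PI / 4 + / INR (S k) * / 2)).
  - exact riemann_mean_bounds.
  - apply is_lim_seq_const.
  - replace (Finite (PI / 4)) with (Finite (PI / 4 + 0 * / 2))
      by (f_equal; ring).
    apply is_lim_seq_plus'; [apply is_lim_seq_const |].
    apply (is_lim_seq_scal_r _ (/ 2) 0).
    apply (is_lim_seq_incr_1 (fun n => / INR n) 0).
    apply (is_lim_seq_inv INR p_infty is_lim_seq_INR).
    discriminate.
Qed.

Lemma leibniz_series : is_series leibniz_term (PI / 4).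
Proof.
  apply (is_series_ext (tg_alt PI_tg)).
  - intro p; unfold tg_alt, PI_tg, leibniz_term.
    rewrite plus_INR, mult_INR.
    change (INR 2) with 2; change (INR 1) with 1.
    unfold Rdiv; rewrite Rmult_1_l; reflexivity.
  - apply is_series_Reals.
    (* [Alt_PI] is by definition four times the sum of this alternating
       series. *)
    rewrite <- Alt_PI_eq; unfold Alt_PI.
    destruct exist_PI as [l Hl].
    replace (4 * l / 4) with l by field.
    exact Hl.
Qed.

(* The index [k] enumerates the positive integers [n = S k].  [Lim_seq] and
   [Series] are total, so the existence of both limits is stated as well. *)
Theorem lemma2 :
  ex_finite_lim_seq (fun k : nat => riemann_mean (S k)) /\
  ex_series leibniz_term /\
  Lim_seq (fun k : nat => riemann_mean (S k)) = Finite (Series leibniz_term).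
Proof.
  split; [| split].
  - exists (PI / 4); exact riemann_mean_lim.
  - exists (PI / 4); exact leibniz_series.
  - rewrite (is_series_unique _ _ leibniz_series).
    exact (is_lim_seq_unique _ _ riemann_mean_lim).
Qed.
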